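(* Let $G$ be a graph, $\ell\in\mathbb{N}$, and $M$ a twin cover of $G$ with $|M|=k$. Assume there exists a collection $\Gamma$ of partial dominator colorings of $G$ such that (i) $M\subseteq S$ for every $(\chi^S,\delta)\in\Gamma$; (ii) for every dominator coloring $\chi'$ of $G$ there is an extension $\chi$ of some element of $\Gamma$ with $|\chi|\le|\chi'|$; (iii) $|\Gamma|=O(2^{O(k\log k)})$ and $\Gamma$ can be constructed in $O^*(2^{O(k\log k)})$ time. Then \textsc{Dominator Coloring} on $(G,\ell)$ can be solved in $O^*(2^{O(k\log k)})$ time.
   Context: Graphs are finite and simple; $N_G[v]=N_G(v)\cup\{v\}$. A set $M\subseteq V(G)$ is a twin cover if for every edge $uv$ either $u\in M$ or $v\in M$, or $N_G[u]=N_G[v]$. A proper coloring assigns different colors to adjacent vertices; $|\chi|$ is the number of colors used. A vertex $v$ dominates a set $T$ if $T\subseteq N_G[v]$. A dominator coloring is a proper coloring in which every vertex dominates some color class. \textsc{Dominator Coloring}: given $(G,\ell)$, decide whether $G$ has a dominator coloring with at most $\ell$ colors. For $S\subseteq V(G)$, a partial coloring $\chi^S:S\to C$ is a proper coloring of $G[S]$. A partial dominator coloring is a pair $(\chi^S,\delta)$ with $\chi^S$ a partial coloring and $\delta:V(G)\to\mathrm{im}(\chi^S)$ such that every $v$ dominates $(\chi^S)^{-1}(\delta(v))$. A dominator coloring $\chi$ is an extension of $(\chi^S,\delta)$ if $\chi$ agrees with $\chi^S$ on $S$ and every $v$ dominates $\chi^{-1}(\delta(v))$. $O^*(\cdot)$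 hides polynomial factors. *)

(* Defs.v *)
From mathcomp Require Import all_boot.
From mathcomp Require Import finmap.
From Stdlib Require Import BinNums.

Set Implicit Arguments.
Unset Strict Implicit.
Unset Printing Implicit Defensive.

(** * Graphs, twin covers and (partial) dominator colorings *)

Record sgraph (T : finType) := SGraph {
  adj : rel T;
  adj_sym : symmetric adj;
  adj_irr : irreflexive adj
}.

Section Graphs.
Variables (T : finType) (G : sgraph T).

Definition clnbh (v : T) : {set T} := [set u | (u == v) || adj G v u].

Definition twin_cover (M : {set T}) : Prop :=
  forall u v, adj G u v -> [\/ u \in M, v \in M | clnbh u = clnbh v].

Definition dominates (v : T) (A : {set T}) : bool := A \subset clnbh v.

(** The set of available colors is [nat]. *)
Definition coloring := {ffun T -> nat}.

Definition color_class (chi : coloring) (c : nat) : {set T} :=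
  [set v | chi v == c].

Definition ncolors (chi : coloring) : nat := size (undup (codom chi)).

Definition proper_coloring (chi : coloring) : Prop :=
  forall u v, adj G u v -> chi u <> chi v.

(** Only colors in the image count: their classes are the nonempty ones. *)
Definition dominator_coloring (chi : coloring) : Prop :=
  proper_coloring chi /\
  forall v, exists2 c, c \in codom chi & dominates v (color_class chi c).

Definition has_dominator_coloring (ell : nat) : Prop :=
  exists2 chi, dominator_coloring chi & ncolors chi <= ell.

(** A map [chi^S : S -> nat] is a function to [option nat], and [S] is the set
    of the vertices whose value is not [None]. *)
Definition pcoloring := {ffun T -> option nat}.

Definition pdomain (chiS : pcoloring) : {set T} := [set v | isSome (chiS v)].

Definition pcolor_class (chiS : pcoloring) (c : nat) : {set T} :=
  [set v | chiS v == Some c].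

Definition partial_coloring (chiS : pcoloring) : Prop :=
  forall u v, u \in pdomain chiS -> v \in pdomain chiS ->
    adj G u v -> chiS u <> chiS v.

(** The underlying data [(chi^S, delta)]. *)
Definition pdcol : Type := pcoloring * {ffun T -> nat}.

Definition partial_dominator_coloring (p : pdcol) : Prop :=
  [/\ partial_coloring p.1,
      forall v, Some (p.2 v) \in codom p.1
    & forall v, dominates v (pcolor_class p.1 (p.2 v))].

Definition extension (p : pdcol) (chi : coloring) : Prop :=
  [/\ dominator_coloring chi,
      forall v, v \in pdomain p.1 -> p.1 v = Some (chi v)
    & forall v, dominates v (color_class chi (p.2 v))].

End Graphs.

(** * Model of computation

    The WHILE language of N. D. Jones (Computability and Complexity from a
    Programming Perspective, MIT Press, 1997): programs over binary trees, in
    which every elementary operation costs one unit of time. It simulates, and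
    is simulated by, Turing machines with polynomial overhead, and the bounds
    [O^*(2^(O(k log k)))] are closed under such an overhead. *)

Inductive tree := Leaf | Node of tree & tree.

Fixpoint tsize (t : tree) : nat :=
  if t is Node l r then (tsize l + tsize r).+1 else 1.

Inductive expr :=
  | EVar of nat
  | ENil
  | ECons of expr & expr
  | EHd of expr
  | ETl of expr.

Inductive cmd :=
  | CAssign of nat & expr
  | CSeq of cmd & cmd
  | CIf of expr & cmd & cmd
  | CWhile of expr & cmd.

Definition store := nat -> tree.

Definition upd (s : store) (x : nat) (t : tree) : store :=
  fun y => if y == x then t else s y.

Fixpoint eval (s : store) (e : expr) : tree :=
  match e with
  | EVar x => s x
  | ENil => Leaf
  | ECons e1 e2 => Node (eval s e1) (eval s e2)
  | EHd e1 => if eval s e1 is Node l _ then l else Leaf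
  | ETl e1 => if eval s e1 is Node _ r then r else Leaf
  end.

Fixpoint ecost (e : expr) : nat :=
  match e with
  | EVar _ | ENil => 1
  | ECons e1 e2 => (ecost e1 + ecost e2).+1
  | EHd e1 | ETl e1 => (ecost e1).+1
  end.

Definition truth (t : tree) : bool := if t is Node _ _ then true else false.

(** [exec c s t s']: started in store [s], the command [c] halts after time [t]
    in store [s']. *)
Inductive exec : cmd -> store -> nat -> store -> Prop :=
  | ExecAssign x e s : exec (CAssign x e) s (ecost e).+1 (upd s x (eval s e))
  | ExecSeq c1 c2 s s1 s2 t1 t2 :
      exec c1 s t1 s1 -> exec c2 s1 t2 s2 -> exec (CSeq c1 c2) s (t1 + t2) s2
  | ExecIf e c1 c2 s s' t :
      exec (if truth (eval s e) then c1 else c2) s t s' ->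
      exec (CIf e c1 c2) s ((ecost e).+1 + t) s'
  | ExecWhileEnd e c s :
      ~~ truth (eval s e) -> exec (CWhile e c) s (ecost e).+1 s
  | ExecWhileStep e c s s1 s2 t1 t2 :
      truth (eval s e) -> exec c s t1 s1 -> exec (CWhile e c) s1 t2 s2 ->
      exec (CWhile e c) s ((ecost e).+1 + t1 + t2) s2.

(** Variable 0 holds the input at the start and the output at the end; all
    other variables start with [Leaf]. *)
Definition runs (c : cmd) (x y : tree) (t : nat) : Prop :=
  exists2 s, exec c (upd (fun _ => Leaf) 0 x) t s & s 0 = y.

(** * Encodings *)

Definition enc_bool (b : bool) : tree := if b then Node Leaf Leaf else Leaf.

Definition enc_seq (A : Type) (enc : A -> tree) (s : seq A) : tree :=
  foldr (fun a t => Node (enc a) t) Leaf s.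

Definition enc_option (A : Type) (enc : A -> tree) (o : option A) : tree :=
  if o is Some a then Node (enc a) Leaf else Leaf.

(** Binary, as a list of bits, least significant bit first. *)
Fixpoint enc_positive (p : positive) : tree :=
  match p with
  | xH => Node (enc_bool true) Leaf
  | xO q => Node (enc_bool false) (enc_positive q)
  | xI q => Node (enc_bool true) (enc_positive q)
  end.

Definition enc_nat (n : nat) : tree :=
  if bin_of_nat n is Npos p then enc_positive p else Leaf.

Definition enc_fun (n : nat) (A : Type) (enc : A -> tree) (f : 'I_n -> A) :
    tree :=
  enc_seq (fun i => enc (f i)) (enum 'I_n).

Definition enc_graph (n : nat) (G : sgraph 'I_n) : tree :=
  enc_fun id (fun u => enc_fun enc_bool (adj G u)).

Definition enc_set (n : nat) (A : {set 'I_n}) : tree :=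
  enc_fun enc_bool (fun v => v \in A).

Definition enc_pdcol (n : nat) (p : pdcol 'I_n) : tree :=
  Node (enc_fun (enc_option enc_nat) p.1) (enc_fun enc_nat p.2).

(** * Instances and running times *)

Record instance := Instance {
  inst_order : nat;
  inst_graph : sgraph 'I_inst_order;
  inst_ell : nat;
  inst_cover : {set 'I_inst_order}
}.

Definition enc_instance (I : instance) : tree :=
  Node (enc_graph (inst_graph I))
    (Node (enc_nat (inst_ell I)) (enc_set (inst_cover I))).

Definition param (I : instance) : nat := #|inst_cover I|.

(** [2 ^ (b * k * log_2 k)], with [0 * log 0 = 0]. *)
Definition exp_klogk (b k : nat) : nat := k ^ (b * k).

(** Some program produces, on every instance [I] of the class [J], an output
    correct for [I] in time [O^*(2^(O(k log k)))], where [k = param I] and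
    [O^*] hides a factor polynomial in the size of the input. *)
Definition computable_in_Ostar_klogk
    (J : instance -> Prop) (correct : instance -> tree -> Prop) : Prop :=
  exists (P : cmd) (a b d : nat), forall I, J I ->
    exists (y : tree) (t : nat),
      [/\ runs P (enc_instance I) y t,
          t <= a * exp_klogk b (param I) * tsize (enc_instance I) ^ d
        & correct I y].

(** The output is a list of the elements of [Gamma I], in any order and with
    possible repetitions. *)
Definition constructible_in_Ostar_klogk (J : instance -> Prop)
    (Gamma : forall I : instance, {fset pdcol 'I_(inst_order I)}) : Prop :=
  computable_in_Ostar_klogk J (fun I y =>
    exists2 s : seq (pdcol 'I_(inst_order I)),
      s =i Gamma I & y = enc_seq (@enc_pdcol (inst_order I)) s).

Definition decidable_in_Ostar_klogk (J Q : instance -> Prop) : Prop :=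
  computable_in_Ostar_klogk J (fun I y =>
    exists2 r : bool, (r <-> Q I) & y = enc_bool r).

(* Main.v *)
From Pilot Require Import Defs.
From mathcomp Require Import all_boot.
From mathcomp Require Import finmap.
From mathcomp Require Import zify.
(* Again, because [tuple.tsize] shadows [Defs.tsize]. *)
Import Pilot.Defs.

Set Implicit Arguments.
Unset Strict Implicit.
Unset Printing Implicit Defensive.

(** Let [(chi^S, delta)] be in [Gamma]. As [M] is a twin cover contained in [S],
    two adjacent vertices outside [S] are twins, so the uncolored part of the
    closed neighborhood of an uncolored vertex [u] is a clique of twins, all of
    which have the same blocked colors: those of a neighbor in [S], and those
    [delta v] with [u] not in [N[v]]. In an extension the clique avoids the
    blocked colors and uses each color at most once. Conversely, fresh colors
    can be shared by distinct cliques. Hence an extension with at most [ell]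
    colors exists iff [chi^S] uses at most [ell] colors and, for every uncolored
    [u], the number of blocked colors plus the size of the clique is at most
    [ell]. This is decided in polynomial time by comparing lists.

    The time [t] of the program that lists [Gamma] does not bound the size of
    its output [y], as trees are built with sharing. It bounds the height of
    [y], though, and an encoding of a list of partial dominator colorings has
    size cubic in its height. *)

(** * Polynomial-time tree functions *)

Definition thd (t : tree) : tree := if t is Node l _ then l else Leaf.
Definition ttl (t : tree) : tree := if t is Node _ r then r else Leaf.

Fixpoint lst (t : tree) : seq tree :=
  if t is Node a r then a :: lst r else [::].

Lemma tsize_gt0 t : 0 < tsize t.
Proof. by case: t. Qed.

Lemma tsize_thd t : tsize (thd t) <= tsize t.
Proof. by case: t => //= l r; lia. Qed.

Lemma tsize_ttl t : tsize (ttl t) <= tsize t.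
Proof. by case: t => //= l r; lia. Qed.

Lemma tsize_enc_bool b : tsize (enc_bool b) <= 3.
Proof. by case: b. Qed.

Lemma truth_enc_bool b : truth (enc_bool b) = b.
Proof. by case: b. Qed.

Lemma size_lst t : size (lst t) < tsize t.
Proof. by elim: t => //= l _ r IH; lia. Qed.

Lemma leq_expl m n e : m <= n -> m ^ e <= n ^ e.
Proof. by case: e => // e; rewrite leq_exp2r. Qed.

Definition pbounded (F : tree -> nat) : Prop :=
  exists a d, forall x, F x <= a * tsize x ^ d.

Lemma pbounded_le F G : (forall x, F x <= G x) -> pbounded G -> pbounded F.
Proof.
by move=> le [a [d H]]; exists a, d => x; exact: leq_trans (le x) (H x).
Qed.

Lemma pbounded_const c : pbounded (fun _ => c).
Proof. by exists c, 0 => x; rewrite muln1. Qed.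

Lemma pbounded_tsize : pbounded tsize.
Proof. by exists 1, 1 => x; rewrite mul1n. Qed.

Lemma pboundedD F G :
  pbounded F -> pbounded G -> pbounded (fun x => F x + G x).
Proof.
move=> [a [d HF]] [b [e HG]]; exists (a + b), (d + e) => x.
rewrite mulnDl leq_add //.
  by apply: leq_trans (HF x) _; rewrite leq_mul2l leq_pexp2l ?tsize_gt0 ?leq_addr ?orbT.
by apply: leq_trans (HG x) _; rewrite leq_mul2l leq_pexp2l ?tsize_gt0 ?leq_addl ?orbT.
Qed.

Lemma pboundedM F G :
  pbounded F -> pbounded G -> pbounded (fun x => F x * G x).
Proof.
move=> [a [d HF]] [b [e HG]]; exists (a * b), (d + e) => x.
by rewrite expnD mulnACA leq_mul.
Qed.

Lemma pboundedX F d : pbounded F -> pbounded (fun x => F x ^ d).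
Proof.
move=> bF; elim: d => [|d IH]; first exact: pbounded_const 1.
by apply: pbounded_le (pboundedM bF IH) => x; rewrite expnS.
Qed.

Lemma pbounded_comp F (f : tree -> tree) :
  pbounded F -> pbounded (fun x => tsize (f x)) -> pbounded (fun x => F (f x)).
Proof.
move=> [a [d HF]] bf; apply: (pbounded_le (fun x => HF (f x))).
exact: pboundedM (pbounded_const a) (pboundedX d bf).
Qed.

(* The input and the output are in variable [N]; the variables above [N] are
   scratch space with arbitrary initial contents. Since [ECons] shares
   subtrees, the time does not bound the size of the output. *)
Definition ptime (f : tree -> tree) : Prop :=
  exists (C : nat -> cmd) (T : tree -> nat),
    [/\ pbounded T, pbounded (fun x => tsize (f x)) &
        forall N s, exists t s',
          [/\ exec (C N) s t s', s' N = f (s N),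
              forall y, y < N -> s' y = s y & t <= T (s N)]].

Definition pdec (b : tree -> bool) : Prop := ptime (fun x => enc_bool (b x)).

Lemma upd_eq s x t : upd s x t x = t.
Proof. by rewrite /upd eqxx. Qed.

Lemma upd_ne s x t y : y != x -> upd s x t y = s y.
Proof. by rewrite /upd => /negbTE ->. Qed.

Lemma ptime_expr (f : tree -> tree) (e : nat -> expr) c :
  (forall N s, eval s (e N) = f (s N)) -> (forall N, ecost (e N) <= c) ->
  pbounded (fun x => tsize (f x)) -> ptime f.
Proof.
move=> ev co bf; exists (fun N => CAssign N (e N)), (fun _ => c.+1).
split=> // [|N s]; first exact: pbounded_const.
exists (ecost (e N)).+1, (upd s N (eval s (e N))); split.
- exact: ExecAssign.
- by rewrite upd_eq ev.
- by move=> y lt; rewrite upd_ne // neq_ltn lt.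
- by rewrite ltnS.
Qed.

Lemma ptime_id : ptime (fun x => x).
Proof. exact: (@ptime_expr (fun x => x) EVar 1 _ _ pbounded_tsize). Qed.

Lemma ptime_leaf : ptime (fun _ => Leaf).
Proof. exact: (@ptime_expr (fun _ => Leaf) (fun _ => ENil) 1 _ _ (pbounded_const 1)). Qed.

Lemma ptime_comp (f g : tree -> tree) :
  ptime f -> ptime g -> ptime (fun x => f (g x)).
Proof.
move=> [C [T [bT bf H]]] [D [U [bU bg K]]].
exists (fun N => CSeq (D N) (C N)), (fun x => U x + T (g x)); split.
- exact: pboundedD bU (pbounded_comp bT bg).
- exact: pbounded_comp bf bg.
move=> N s; have [t [s' [e v p l]]] := K N s.
have [t2 [s2 [e2 v2 p2 l2]]] := H N s'.
exists (t + t2), s2; split; first exact: ExecSeq e e2.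
- by rewrite v2 v.
- by move=> y lt; rewrite p2 // p.
- by rewrite leq_add // -v.
Qed.

Lemma ptime_hd f : ptime f -> ptime (fun x => thd (f x)).
Proof.
move=> pf; apply: (ptime_comp (f := thd)) pf.
apply: (@ptime_expr _ (fun N => EHd (EVar N)) 2) => //.
exact: pbounded_le tsize_thd pbounded_tsize.
Qed.

Lemma ptime_tl f : ptime f -> ptime (fun x => ttl (f x)).
Proof.
move=> pf; apply: (ptime_comp (f := ttl)) pf.
apply: (@ptime_expr _ (fun N => ETl (EVar N)) 2) => //.
exact: pbounded_le tsize_ttl pbounded_tsize.
Qed.

Lemma ptime_node f g :
  ptime f -> ptime g -> ptime (fun x => Node (f x) (g x)).
Proof.
move=> [C [T [bT bf H]]] [D [U [bU bg K]]].
exists (fun N => CSeq (CAssign N.+1 (EVar N)) (CSeq (C N.+1)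
  (CSeq (CAssign N.+2 (EVar N)) (CSeq (D N.+2)
  (CAssign N (ECons (EVar N.+1) (EVar N.+2))))))).
exists (fun x => T x + U x + 8); split.
- exact: pboundedD (pboundedD bT bU) (pbounded_const _).
- apply: (@pbounded_le _ (fun x => tsize (f x) + tsize (g x) + 1)).
    by move=> x /=; lia.
  exact: pboundedD (pboundedD bf bg) (pbounded_const _).
move=> N s.
pose s1 := upd s N.+1 (s N).
have [t2 [s2 [e2 v2 p2 l2]]] := H N.+1 s1.
pose s3 := upd s2 N.+2 (s2 N).
have [t4 [s4 [e4 v4 p4 l4]]] := K N.+2 s3.
have s2N : s2 N = s N by rewrite p2 // /s1 upd_ne // neq_ltn ltnSn.
rewrite /s1 upd_eq in v2 l2; rewrite /s3 upd_eq s2N in v4 l4.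
eexists _, _; split.
- apply: ExecSeq; first exact: ExecAssign.
  apply: ExecSeq; first exact: e2.
  apply: ExecSeq; first exact: ExecAssign.
  by apply: ExecSeq; [exact: e4|exact: ExecAssign].
- by rewrite upd_eq /= v4 p4 // /s3 upd_ne ?v2 // neq_ltn ltnSn.
- move=> y lt; rewrite upd_ne ?p4 /s3 ?upd_ne ?p2 /s1 ?upd_ne //; lia.
- by rewrite /=; lia.
Qed.

Lemma ptime_if_truth b f g : ptime b -> ptime f -> ptime g ->
  ptime (fun x => if truth (b x) then f x else g x).
Proof.
move=> [B [V [bV _ L]]] [C [T [bT bf H]]] [D [U [bU bg K]]].
exists (fun N => CSeq (CAssign N.+1 (EVar N)) (CSeq (B N.+1)
  (CIf (EVar N.+1) (C N) (D N)))).
exists (fun x => V x + T x + U x + 4); split.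
- exact: pboundedD (pboundedD (pboundedD bV bT) bU) (pbounded_const _).
- apply: (@pbounded_le _ (fun x => tsize (f x) + tsize (g x))).
    by move=> x /=; case: (truth _); lia.
  exact: pboundedD bf bg.
move=> N s.
pose s1 := upd s N.+1 (s N).
have [t2 [s2 [e2 v2 p2 l2]]] := L N.+1 s1.
have s2N : s2 N = s N by rewrite p2 // /s1 upd_ne // neq_ltn ltnSn.
rewrite /s1 upd_eq in v2 l2.
have [t3 [s3 [e3 v3 p3 l3]]] : exists t s', [/\ exec (if truth (b (s N)) then C N else D N) s2 t s',
  s' N = (if truth (b (s N)) then f (s N) else g (s N)), forall y, y < N -> s' y = s2 y
  & t <= T (s N) + U (s N)].
  case: (truth _).
    have [t [s' [e v p l]]] := H N s2.
    by exists t, s'; rewrite -s2N; split=> //; apply: leq_trans l (leq_addr _ _).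
  have [t [s' [e v p l]]] := K N s2.
  by exists t, s'; rewrite -s2N; split=> //; apply: leq_trans l (leq_addl _ _).
eexists _, s3; split; try exact: v3.
- apply: ExecSeq; first exact: ExecAssign.
  apply: ExecSeq; first exact: e2.
  by apply: ExecIf; rewrite /= v2; exact: e3.
- move=> y lt; rewrite p3 // p2 /s1 ?upd_ne //; lia.
- by rewrite /=; lia.
Qed.

Lemma eq_ptime f g : f =1 g -> ptime f -> ptime g.
Proof.
move=> fg [C [T [bT bf H]]]; exists C, T; split=> //.
  by apply: pbounded_le bf => x; rewrite fg.
move=> N s; have [t [s' [e v p l]]] := H N s.
by exists t, s'; rewrite -fg.
Qed.

Lemma ptime_if b f g : pdec b -> ptime f -> ptime g ->
  ptime (fun x => if b x then f x else g x).
Proof.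
move=> pb pf pg; apply: eq_ptime (ptime_if_truth pb pf pg) => x.
by rewrite truth_enc_bool.
Qed.

Lemma ptime_true : ptime (fun _ => enc_bool true).
Proof. exact: ptime_node ptime_leaf ptime_leaf. Qed.

Lemma pdec_truth f : ptime f -> pdec (fun x => truth (f x)).
Proof.
move=> pf; apply: eq_ptime (ptime_if_truth pf ptime_true ptime_leaf) => x.
by case: (truth _).
Qed.

Lemma pdec_and b c : pdec b -> pdec c -> pdec (fun x => b x && c x).
Proof.
move=> pb pc; apply: eq_ptime (ptime_if pb pc ptime_leaf) => x.
by case: (b x).
Qed.

Lemma pdec_or b c : pdec b -> pdec c -> pdec (fun x => b x || c x).
Proof.
move=> pb pc; apply: eq_ptime (ptime_if pb ptime_true pc) => x.
by case: (b x).
Qed.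

Lemma pdec_neg b : pdec b -> pdec (fun x => ~~ b x).
Proof.
move=> pb; apply: eq_ptime (ptime_if pb ptime_leaf ptime_true) => x.
by case: (b x).
Qed.

Lemma ptime_foldl (f : tree -> tree -> tree -> tree) h g B :
  ptime (fun z => f (ttl (ttl z)) (thd z) (thd (ttl z))) ->
  ptime h -> ptime g -> pbounded B ->
  (forall x l1 l2, lst (g x) = l1 ++ l2 -> tsize (foldl (f x) (h x) l1) <= B x) ->
  ptime (fun x => foldl (f x) (h x) (lst (g x))).
Proof.
move=> [C [T [[a [d bT]] _ H]]] [D [U [bU bh K]]] [E [V [bV bg L]]] bB accB.
pose S x := tsize (g x) * (a * (B x + tsize (g x) + tsize x + 2) ^ d + 14).
exists (fun N => CSeq (CAssign N.+1 (EVar N)) (CSeq (E N.+1)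
  (CSeq (CAssign N.+2 (EVar N)) (CSeq (D N.+2) (CSeq
  (CWhile (EVar N.+1)
    (CSeq (CAssign N.+3 (ECons (EVar N.+2) (ECons (EHd (EVar N.+1)) (EVar N))))
    (CSeq (C N.+3) (CSeq (CAssign N.+2 (EVar N.+3))
      (CAssign N.+1 (ETl (EVar N.+1)))))))
  (CAssign N (EVar N.+2))))))).
exists (fun x => V x + U x + S x + 8); split.
- apply: pboundedD (pbounded_const _); apply: pboundedD.
    exact: pboundedD bV bU.
  apply: (pboundedM bg); apply: pboundedD (pbounded_const _).
  apply: pboundedM (pbounded_const _) (pboundedX d _).
  apply: pboundedD (pbounded_const _).
  exact: pboundedD (pboundedD bB bg) pbounded_tsize.
- apply: (@pbounded_le _ B) => // x.
  by apply: (accB x _ [::]); rewrite cats0.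
move=> N s; set x := s N.
pose s1 := upd s N.+1 x.
have [t2 [s2 [e2 v2 p2 l2]]] := L N.+1 s1.
pose s3 := upd s2 N.+2 (s2 N).
have [t4 [s4 [e4 v4 p4 l4]]] := K N.+2 s3.
have s2N : s2 N = x by rewrite p2 // /s1 upd_ne // neq_ltn ltnSn.
rewrite /s1 upd_eq in v2 l2; rewrite /s3 upd_eq s2N in v4 l4.
have s4g : s4 N.+1 = g x by rewrite p4 // /s3 upd_ne ?v2 // neq_ltn ltnSn.
have s4l y : y <= N -> s4 y = s y.
  move=> le; rewrite p4 /s3; last by lia.
  rewrite upd_ne; last by lia.
  rewrite p2 /s1; last by lia.
  by rewrite upd_ne; last by lia.
pose W c := exists t s', [/\ exec (CWhile (EVar N.+1) c) s4 t s',
    s' N.+2 = foldl (f x) (h x) (lst (g x)), forall y, y <= N -> s' y = s y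
  & t <= S x + 2].
suff [t5 [s5 [e5 v5 p5 l5]]] : W (CSeq (CAssign N.+3 (ECons (EVar N.+2) (ECons (EHd (EVar N.+1)) (EVar N))))
    (CSeq (C N.+3) (CSeq (CAssign N.+2 (EVar N.+3))
      (CAssign N.+1 (ETl (EVar N.+1)))))).
  eexists _, _; split.
  - apply: ExecSeq; first exact: ExecAssign.
    apply: ExecSeq; first exact: e2.
    apply: ExecSeq; first exact: ExecAssign.
    apply: ExecSeq; first exact: e4.
    by apply: ExecSeq; [exact: e5|exact: ExecAssign].
  - by rewrite upd_eq /= v5.
  - by move=> y lt; rewrite upd_ne ?p5 //; lia.
  - by rewrite /=; lia.
rewrite {}/W; set c := CSeq _ _.
suff loop : forall r l1 st, lst (g x) = l1 ++ lst r -> tsize r <= tsize (g x) ->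
    st N.+1 = r -> st N.+2 = foldl (f x) (h x) l1 ->
    (forall y, y <= N -> st y = s y) ->
    exists t s', [/\ exec (CWhile (EVar N.+1) c) st t s',
       s' N.+2 = foldl (f x) (h x) (lst (g x)), forall y, y <= N -> s' y = s y
     & t <= tsize r * (a * (B x + tsize (g x) + tsize x + 2) ^ d + 14) + 2].
  by apply: (loop (g x) [::]).
elim=> [|hd _ tl IH] l1 st.
  rewrite /= cats0 => -> _ str sta stl; eexists _, st; split; try exact: sta; try exact: stl.
  - by apply: ExecWhileEnd; rewrite /= str.
  - by rewrite /=; lia.
move=> gE rs str sta stl.
pose st1 := upd st N.+3 (Node (st N.+2) (Node hd x)).
have [t6 [st2 [f2 w2 q2 m2]]] := H N.+3 st1.
rewrite /st1 upd_eq /= in w2 m2.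
pose st3 := upd st2 N.+2 (st2 N.+3).
pose st4 := upd st3 N.+1 (ttl (st3 N.+1)).
have st3N : st3 N.+1 = Node hd tl.
  rewrite /st3 upd_ne; last by lia.
  rewrite q2; last by lia.
  by rewrite /st1 upd_ne ?str; last by lia.
have [t7 [s7 [e7 v7 p7 l7]]] : exists t s', [/\ exec (CWhile (EVar N.+1) c) st4 t s',
       s' N.+2 = foldl (f x) (h x) (lst (g x)), forall y, y <= N -> s' y = s y
     & t <= tsize tl * (a * (B x + tsize (g x) + tsize x + 2) ^ d + 14) + 2].
  apply: (IH (rcons l1 hd)).
  - by rewrite cat_rcons.
  - by move: rs => /=; lia.
  - by rewrite /st4 upd_eq st3N.
  - by rewrite /st4 upd_ne /st3 ?upd_eq ?w2 ?sta ?foldl_rcons //; lia.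
  - move=> y le; rewrite /st4 upd_ne; last by lia.
    rewrite /st3 upd_ne; last by lia.
    rewrite q2; last by lia.
    by rewrite /st1 upd_ne ?stl; last by lia.
have accb : tsize (st N.+2) <= B x by rewrite sta; apply: accB gE.
have t6b : t6 <= a * (B x + tsize (g x) + tsize x + 2) ^ d.
  apply: leq_trans m2 _; apply: leq_trans (bT _) _.
  by rewrite leq_mul2l leq_expl ?orbT //; move: rs accb => /=; lia.
eexists _, s7; split; try exact: v7; try exact: p7.
- apply: ExecWhileStep; [by rewrite /= str| |exact: e7].
  apply: ExecSeq; first exact: ExecAssign.
  have -> : upd st N.+3 (eval st (ECons (EVar N.+2) (ECons (EHd (EVar N.+1)) (EVar N)))) = st1.
    by rewrite /= str (stl N).
  apply: ExecSeq; first exact: f2.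
  by apply: ExecSeq; exact: ExecAssign.
- rewrite /=; lia.
Qed.

(** * List processing *)

Lemma pdec_comp2 (P : tree -> tree -> bool) f g :
  pdec (fun z => P (ttl z) (thd z)) -> ptime f -> ptime g ->
  pdec (fun x => P (f x) (g x)).
Proof.
by move=> pP pf pg; have := ptime_comp pP (ptime_node pg pf).
Qed.

Lemma pdec_has (P : tree -> tree -> bool) g :
  pdec (fun z => P (ttl z) (thd z)) -> ptime g ->
  pdec (fun x => has (P x) (lst (g x))).
Proof.
move=> pP pg.
pose f x acc a := enc_bool (truth acc || P x a).
have fE x l b : foldl (f x) (enc_bool b) l = enc_bool (b || has (P x) l).
  elim: l b => [|a l IH] b /=; first by rewrite orbF.
  by rewrite /f truth_enc_bool IH orbA.
apply: (@eq_ptime (fun x => foldl (f x) Leaf (lst (g x)))).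
  by move=> x; rewrite -[Leaf]/(enc_bool false) fE.
apply: (ptime_foldl _ ptime_leaf pg (pbounded_const 3)).
  apply: pdec_or; first exact: pdec_truth (ptime_hd ptime_id).
  apply: (pdec_comp2 pP); first exact: ptime_tl (ptime_tl ptime_id).
  exact: ptime_hd (ptime_tl ptime_id).
by move=> x l1 l2 _; rewrite -[Leaf]/(enc_bool false) fE tsize_enc_bool.
Qed.

Definition tcount (P : pred tree) (h t : tree) : tree :=
  foldl (fun acc a => if P a then Node Leaf acc else acc) h (lst t).

Lemma size_tcount P h t :
  size (lst (tcount P h t)) = count P (lst t) + size (lst h).
Proof.
rewrite /tcount; elim: (lst t) h => [|a l IH] h //=.
by rewrite IH; case: (P a) => /=; lia.
Qed.

Lemma ptime_tcount (P : tree -> tree -> bool) h g :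
  pdec (fun z => P (ttl z) (thd z)) -> ptime h -> ptime g ->
  ptime (fun x => tcount (P x) (h x) (g x)).
Proof.
move=> pP ph pg.
have [C [T [_ bg _]]] := pg; have [D [U [_ bh _]]] := ph.
apply: (ptime_foldl (f := fun x acc a => if P x a then Node Leaf acc else acc)
         _ ph pg (pboundedD bh (pboundedM (pbounded_const 2) bg))).
  apply: ptime_if; last exact: ptime_hd ptime_id; last first.
    exact: ptime_node ptime_leaf (ptime_hd ptime_id).
  apply: (pdec_comp2 pP); first exact: ptime_tl (ptime_tl ptime_id).
  exact: ptime_hd (ptime_tl ptime_id).
move=> x l1 l2 gE.
have : size l1 <= tsize (g x).
  by have := size_lst (g x); rewrite gE size_cat; lia.
suff : tsize (foldl (fun acc a => if P x a then Node Leaf acc else acc) (h x) l1)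
    <= tsize (h x) + 2 * size l1 by lia.
elim: {l2 gE} l1 (h x) => [|a l IH] y /=; first by lia.
by apply: leq_trans (IH _) _; case: (P x a) => /=; lia.
Qed.

Definition tnth_unary (l i : tree) : tree :=
  thd (foldl (fun acc _ => ttl acc) l (lst i)).

Lemma ptime_tnth f g :
  ptime f -> ptime g -> ptime (fun x => tnth_unary (f x) (g x)).
Proof.
move=> pf pg; have [C [T [_ bf _]]] := pf; apply: ptime_hd.
apply: (ptime_foldl (f := fun _ acc _ => ttl acc) _ pf pg bf).
  exact: ptime_tl (ptime_hd ptime_id).
move=> x l1 l2 _; elim: l1 (f x) => [|a l IH] y //=.
exact: leq_trans (IH _) (tsize_ttl _).
Qed.

Definition teq_step (acc a : tree) : tree :=
  Node (enc_bool (truth (thd acc) &&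
         (truth (ttl acc) && ~~ (truth (thd (ttl acc)) (+) truth a))))
    (ttl (ttl acc)).

Definition teqb (t u : tree) : bool :=
  let r := foldl teq_step (Node (enc_bool true) u) (lst t) in
  truth (thd r) && ~~ truth (ttl r).

Lemma teqbE t u : teqb t u = (map truth (lst t) == map truth (lst u)).
Proof.
rewrite /teqb; suff H b : let r := foldl teq_step (Node (enc_bool b) u) (lst t) in
   truth (thd r) && ~~ truth (ttl r) = b && (map truth (lst t) == map truth (lst u)).
  exact: H true.
elim: (lst t) u b => [|a l IH] [|h r] b /=.
- by rewrite truth_enc_bool andbT.
- by rewrite truth_enc_bool.
- by rewrite /teq_step /= IH !andbF.
- rewrite /teq_step /= IH truth_enc_bool eqseq_cons -andbA.
  by case: (truth h); case: (truth a).
Qed.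

Lemma pdec_teqb f g : ptime f -> ptime g -> pdec (fun x => teqb (f x) (g x)).
Proof.
move=> pf pg; have [C [T [_ bg _]]] := pg.
have pr : ptime (fun x => foldl teq_step (Node (enc_bool true) (g x)) (lst (f x))).
  apply: (ptime_foldl (f := fun _ => teq_step) _ _ pf (pboundedD bg (pbounded_const 5))).
  - have p1 := ptime_hd ptime_id; have p2 := ptime_tl p1.
    have p3 := ptime_hd p2; have p4 := ptime_hd (ptime_tl ptime_id).
    apply: ptime_node (ptime_tl p2).
    apply: pdec_and; first exact: pdec_truth (ptime_hd p1).
    apply: pdec_and; first exact: pdec_truth p2.
    apply: pdec_neg; apply: (@eq_ptime (fun x => if truth (thd (ttl (thd x)))
      then enc_bool (~~ truth (thd (ttl x))) else enc_bool (truth (thd (ttl x))))).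
      by move=> x; case: (truth _).
    apply: ptime_if (pdec_truth p4); first exact: pdec_truth.
    exact/pdec_neg/pdec_truth.
  - exact: ptime_node ptime_true pg.
  move=> x l1 l2 _.
  suff : forall b, tsize (foldl teq_step (Node (enc_bool b) (g x)) l1) <= tsize (g x) + 5.
    by apply.
  elim: l1 (g x) => [|a l IH] y b /=; first by have := tsize_enc_bool b; lia.
  by apply: leq_trans (IH _ _) _; have := tsize_ttl y; rewrite /=; lia.
by apply: pdec_and; [apply/pdec_truth/ptime_hd|apply/pdec_neg/pdec_truth/ptime_tl].
Qed.

Definition thalf_step (acc : tree) : tree :=
  if truth (thd acc) then Node Leaf (ttl acc)
  else Node (enc_bool true) (Node Leaf (ttl acc)).

Definition unary (n : nat) : tree := iter n (Node Leaf) Leaf.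

Lemma lst_unary n : lst (unary n) = nseq n Leaf.
Proof. by elim: n => //= n ->. Qed.

Lemma size_lst_unary n : size (lst (unary n)) = n.
Proof. by rewrite lst_unary size_nseq. Qed.

Lemma tsize_unary n : tsize (unary n) = n.*2.+1.
Proof. by elim: n => //= n ->; rewrite doubleS; lia. Qed.

Lemma size_lst_double t : (size (lst t)).*2 < tsize t.
Proof. by elim: t => //= l _ r IH; have := tsize_gt0 l; lia. Qed.

(* Halves the length of a list, rounding up. *)
Definition thalf (t : tree) : tree :=
  ttl (foldl (fun acc _ => thalf_step acc) (Node Leaf Leaf) (lst t)).

Lemma foldl_thalf_step (l : seq tree) b n :
  foldl (fun acc _ => thalf_step acc) (Node (enc_bool b) (unary n)) l =
  Node (enc_bool (b (+) odd (size l))) (unary ((size l + ~~ b)./2 + n)).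
Proof.
elim: l b n => [|a l IH] b n /=; first by case: b.
rewrite /thalf_step /= truth_enc_bool; case: b => /=.
  by rewrite (IH false) addn0 addn1; case: (odd _).
by rewrite (IH true n.+1) addn0 addn1 /= addnS; case: (odd _).
Qed.

Lemma thalfE t : thalf t = unary (uphalf (size (lst t))).
Proof. by rewrite /thalf (foldl_thalf_step _ false 0) /= addn0 addn1 uphalfE. Qed.

Lemma ptime_thalf f : ptime f -> ptime (fun x => thalf (f x)).
Proof.
move=> pf; have [C [T [_ bf _]]] := pf; apply: ptime_tl.
apply: (ptime_foldl (f := fun _ acc _ => thalf_step acc) _ (ptime_node ptime_leaf ptime_leaf) pf
   (pboundedD bf (pbounded_const 6))).
  have p1 := ptime_hd ptime_id; have p2 := ptime_tl p1.
  apply: ptime_if; first exact: pdec_truth (ptime_hd p1).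
    exact: ptime_node ptime_leaf p2.
  exact: ptime_node ptime_true (ptime_node ptime_leaf p2).
move=> x l1 l2 fE; rewrite (foldl_thalf_step l1 false 0) /= tsize_unary.
have := size_lst_double (f x); rewrite fE size_cat.
by have := tsize_enc_bool (odd (size l1)); lia.
Qed.

Definition tleq_step (acc b : tree) : tree :=
  thalf (if truth b then ttl acc else acc).

(* The length of [t] is compared with the number whose binary digits are [u],
   using [m <= b + 2 q <-> uphalf (m - b) <= q]. *)
Definition tleq (t u : tree) : bool := ~~ truth (foldl tleq_step t (lst u)).

Definition bitval (l : seq tree) : nat :=
  foldr (fun b n => truth b + n.*2) 0 l.

Lemma tleqE t u : tleq t u = (size (lst t) <= bitval (lst u)).
Proof.
rewrite /tleq; elim: (lst u) t => [|b l IH] t /=; first by case: t.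
rewrite IH /tleq_step thalfE size_lst_unary.
by case: (truth b); case: t => //= a r; lia.
Qed.

Lemma tsize_tleq_step t b : tsize (tleq_step t b) <= tsize t.
Proof.
rewrite /tleq_step thalfE tsize_unary.
have H u : (uphalf (size (lst u))).*2.+1 <= tsize u by have := size_lst_double u; lia.
by case: (truth b) => //; apply: leq_trans (H _) (tsize_ttl _).
Qed.

Lemma pdec_tleq f g : ptime f -> ptime g -> pdec (fun x => tleq (f x) (g x)).
Proof.
move=> pf pg; have [C [T [_ bf _]]] := pf; apply/pdec_neg/pdec_truth.
apply: (ptime_foldl (f := fun _ => tleq_step) _ pf pg bf).
  have p1 := ptime_hd ptime_id; apply/ptime_thalf/ptime_if => //; last exact: ptime_tl.
  exact: pdec_truth (ptime_hd (ptime_tl ptime_id)).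
move=> x l1 l2 _; elim: l1 (f x) => [|a l IH] y //=.
exact: leq_trans (IH _) (tsize_tleq_step _ _).
Qed.

Definition tverts_step (acc : tree) : tree :=
  Node (if truth acc then Node Leaf (thd acc) else Leaf) acc.

Definition tverts (t : tree) : tree := 
  foldl (fun acc _ => tverts_step acc) Leaf (lst t).

Lemma foldl_tverts_step (l : seq tree) :
  foldl (fun acc _ => tverts_step acc) Leaf l =
  enc_seq unary (rev (iota 0 (size l))).
Proof.
elim/last_ind: l => // l a IH; rewrite foldl_rcons IH size_rcons.
rewrite -addn1 iotaD rev_cat /= add0n /tverts_step.
by case: (size l) => // n; rewrite -addn1 iotaD rev_cat /= add0n addn1.
Qed.

Lemma lst_enc_seq (A : Type) (enc : A -> tree) l : lst (enc_seq enc l) = map enc l.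
Proof. by elim: l => //= a l ->. Qed.

Lemma lst_tverts t : lst (tverts t) = map unary (rev (iota 0 (size (lst t)))).
Proof. by rewrite /tverts foldl_tverts_step lst_enc_seq. Qed.

Lemma tsize_enc_seq (A : Type) (enc : A -> tree) (l : seq A) B :
  (forall a, List.In a l -> tsize (enc a) <= B) ->
  tsize (enc_seq enc l) <= (size l) * B.+1 + 1.
Proof.
elim: l => //= a l IH H; have := H a (or_introl erefl).
have := IH (fun b Hb => H b (or_intror Hb)); rewrite mulSn; lia.
Qed.

Lemma ptime_tverts f : ptime f -> ptime (fun x => tverts (f x)).
Proof.
move=> pf; have [C [T [_ bf _]]] := pf.
have bB := pboundedD (pboundedM bf (pboundedM (pbounded_const 4) bf)) (pbounded_const 1).
apply: (ptime_foldl (f := fun _ acc _ => tverts_step acc) _ ptime_leaf pf bB).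
  have p1 := ptime_hd ptime_id; apply: (ptime_node _ p1).
  apply: ptime_if ptime_leaf; first exact: pdec_truth.
  exact: ptime_node ptime_leaf (ptime_hd p1).
move=> x l1 l2 fE; rewrite foldl_tverts_step.
have sz : size l1 < tsize (f x).
  by have := size_lst (f x); rewrite fE size_cat; lia.
apply: leq_trans (tsize_enc_seq (B := (size l1).*2.+1) _) _; last first.
  rewrite size_rev size_iota leq_add2r leq_mul //; lia.
move=> i; rewrite tsize_unary => Hi.
have : i \in rev (iota 0 (size l1)).
  elim: (rev _) Hi => //= b l IH [->|/IH]; rewrite in_cons ?eqxx // => ->.
  by rewrite orbT.
by rewrite mem_rev mem_iota; lia.
Qed.

Definition tcolors_step (acc a : tree) : tree :=
  if truth a && ~~ has (teqb (thd a)) (lst acc) then Node (thd a) acc else acc.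

Definition tcolors (t : tree) : tree := foldl tcolors_step Leaf (lst t).

Lemma ptime_tcolors f : ptime f -> ptime (fun x => tcolors (f x)).
Proof.
move=> pf; have [C [T [_ bf _]]] := pf.
apply: (ptime_foldl (f := fun _ => tcolors_step) _ ptime_leaf pf bf).
  have p1 := ptime_hd ptime_id; have p2 := ptime_hd (ptime_tl ptime_id).
  apply: ptime_if => //; last exact: ptime_node (ptime_hd p2) p1.
  apply: pdec_and; first exact: pdec_truth.
  apply/pdec_neg/(pdec_has (P := fun z => teqb (thd (thd (ttl z))))) => //.
  apply: pdec_teqb p1.
  exact: ptime_hd (ptime_hd (ptime_tl (ptime_tl ptime_id))).
move=> x l1 l2 fE.
suff H : forall l u, tsize (foldl tcolors_step u l) + tsize (enc_seq id l2) <= tsize u + tsize (enc_seq id (l ++ l2)).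
  have tE : enc_seq id (lst (f x)) = f x.
    by elim: (f x) => //= h _ r ->.
  rewrite -tE fE; have := H l1 Leaf; have := tsize_gt0 (enc_seq id l2); rewrite /=; lia.
elim=> [|a l IH] u //=; apply: leq_trans (IH _) _.
rewrite /tcolors_step; case: ifP => _ /=; last by lia.
by have := tsize_thd a; lia.
Qed.

(** * The decision procedure on encodings *)

Definition tadj (g u w : tree) : bool := truth (tnth_unary (tnth_unary g u) w).

Definition tblocked (g c d u col : tree) : bool :=
  has (fun w =>
    (truth (tnth_unary c w) && teqb (thd (tnth_unary c w)) col && tadj g u w) ||
    (teqb (tnth_unary d w) col && ~~ (teqb w u || tadj g w u)))
  (lst (tverts g)).

Definition tdemand (g c d u : tree) : tree :=
  tcount (tblocked g c d u)
    (tcount (fun w => ~~ truth (tnth_unary c w) && (teqb w u || tadj g u w))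
       Leaf (tverts g))
    (tcolors c).

Definition tcheck (g ell c d : tree) : bool :=
  tleq (tcolors c) ell &&
  ~~ has (fun u => ~~ (truth (tnth_unary c u) || tleq (tdemand g c d u) ell))
       (lst (tverts g)).

Definition tdecide (x : tree) : bool :=
  has (fun p => tcheck (thd (thd x)) (thd (ttl (thd x))) (thd p) (ttl p))
    (lst (ttl x)).

Ltac ptime_step :=
  match goal with
  | |- ptime (fun x => x) => exact ptime_id
  | |- ptime (fun _ => Leaf) => exact ptime_leaf
  | |- ptime (fun x => thd (@?f x)) => apply (@ptime_hd f); cbv beta
  | |- ptime (fun x => ttl (@?f x)) => apply (@ptime_tl f); cbv beta
  | |- ptime (fun x => tnth_unary (@?f x) (@?g x)) =>
      apply (@ptime_tnth f g); cbv beta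
  | |- ptime (fun x => tverts (@?f x)) => apply (@ptime_tverts f); cbv beta
  | |- ptime (fun x => tcolors (@?f x)) => apply (@ptime_tcolors f); cbv beta
  | |- ptime (fun x => tcount (@?P x) (@?h x) (@?g x)) =>
      apply (@ptime_tcount P h g); cbv beta
  | |- pdec (fun x => truth (@?f x)) => apply (@pdec_truth f); cbv beta
  | |- pdec (fun x => @?b x && @?c x) => apply (@pdec_and b c); cbv beta
  | |- pdec (fun x => @?b x || @?c x) => apply (@pdec_or b c); cbv beta
  | |- pdec (fun x => ~~ @?b x) => apply (@pdec_neg b); cbv beta
  | |- pdec (fun x => has (@?P x) (lst (@?g x))) =>
      apply (@pdec_has P g); cbv beta
  | |- pdec (fun x => teqb (@?f x) (@?g x)) => apply (@pdec_teqb f g); cbv beta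
  | |- pdec (fun x => tleq (@?f x) (@?g x)) => apply (@pdec_tleq f g); cbv beta
  end.

Lemma pdec_tdecide : pdec tdecide.
Proof.
change (pdec (fun x => tdecide x)).
rewrite /tdecide /tcheck /tdemand /tblocked /tadj.
by repeat ptime_step.
Qed.

Lemma tnth_unaryE t i : tnth_unary t (unary i) = nth Leaf (lst t) i.
Proof.
rewrite /tnth_unary lst_unary; elim: i t => [|i IH] [|h r] //=.
by rewrite (IH Leaf) nth_nil.
Qed.

Lemma tnth_enc_fun n (A : Type) (enc : A -> tree) (f : 'I_n -> A) (i : 'I_n) :
  tnth_unary (enc_fun enc f) (unary i) = enc (f i).
Proof.
rewrite tnth_unaryE lst_enc_seq (nth_map i) ?size_enum_ord //.
by rewrite nth_ord_enum.
Qed.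

Lemma tadj_enc_graph n (G : sgraph 'I_n) (u w : 'I_n) :
  tadj (enc_graph G) (unary u) (unary w) = adj G u w.
Proof. by rewrite /tadj !tnth_enc_fun truth_enc_bool. Qed.

Lemma lst_tverts_graph n (G : sgraph 'I_n) :
  lst (tverts (enc_graph G)) = map (fun i : 'I_n => unary i) (rev (enum 'I_n)).
Proof.
rewrite lst_tverts lst_enc_seq size_map size_enum_ord -val_enum_ord.
by rewrite -map_rev -map_comp.
Qed.

Lemma has_tverts n (G : sgraph 'I_n) P :
  has P (lst (tverts (enc_graph G))) = [exists i : 'I_n, P (unary i)].
Proof.
rewrite lst_tverts_graph has_map has_rev.
apply/hasP/existsP => [[i _ Pi]|[i Pi]]; first by exists i.
by exists i; rewrite ?mem_enum.
Qed.

Lemma count_tverts n (G : sgraph 'I_n) P :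
  count P (lst (tverts (enc_graph G))) = #|[set i : 'I_n | P (unary i)]|.
Proof.
rewrite lst_tverts_graph count_map count_rev enumT cardE /enum_mem.
by rewrite size_filter; apply: eq_count => i /=; rewrite inE.
Qed.

Lemma bitval_enc_positive p : bitval (lst (enc_positive p)) = nat_of_pos p.
Proof. by elim: p => [p|p|] //= ->; rewrite ?truth_enc_bool ?NatTrec.doubleE. Qed.

Lemma bitval_enc_nat m : bitval (lst (enc_nat m)) = m.
Proof.
rewrite /enc_nat -[RHS]bin_of_natK; case: (bin_of_nat m) => //= p.
exact: bitval_enc_positive.
Qed.

Lemma teqb_enc_nat a b : teqb (enc_nat a) (enc_nat b) = (a == b).
Proof.
rewrite teqbE; apply/eqP/eqP => [e|-> //].
have bv l : bitval l = foldr (fun (b : bool) n => b + n.*2) 0 (map truth l).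
  by elim: l => //= h l ->.
by rewrite -(bitval_enc_nat a) -(bitval_enc_nat b) !bv e.
Qed.

Lemma teqb_unary i j : teqb (unary i) (unary j) = (i == j).
Proof.
rewrite teqbE !lst_unary !map_nseq; apply/eqP/eqP => [|-> //].
by move/(congr1 size); rewrite !size_nseq.
Qed.

Lemma tcolors_enc_seq (l : seq (option nat)) :
  exists im, [/\ lst (tcolors (enc_seq (enc_option enc_nat) l)) = map enc_nat im,
    uniq im & forall c, (c \in im) = (Some c \in l)].
Proof.
rewrite /tcolors lst_enc_seq; elim/last_ind: l => [|l o [im [lE im_uniq imE]]].
  by exists [::].
rewrite map_rcons foldl_rcons /tcolors_step.
case: o => [c|] /=; last first.
  by exists im; split=> // c; rewrite mem_rcons inE imE.
have -> : has (teqb (enc_nat c)) (lst (foldl tcolors_step Leaf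
    [seq enc_option enc_nat i | i <- l])) = (c \in im).
  rewrite lE has_map; apply/hasP/idP => [[c' c'im /=]|cim].
    by rewrite teqb_enc_nat => /eqP ->.
  by exists c => //=; rewrite teqb_enc_nat.
case: (boolP (c \in im)) => cim /=.
  exists im; split=> // c'; rewrite mem_rcons inE -imE /eq_op /=.
  by case: eqP => // ->.
exists (c :: im); split=> /=; [by rewrite lE|by rewrite cim|].
by move=> c'; rewrite mem_rcons !inE imE.
Qed.

Section Criterion.
Variables (n : nat) (G : sgraph 'I_n) (p : pdcol 'I_n).

Definition blocked (u : 'I_n) (c : nat) : bool :=
  [exists w, (p.1 w == Some c) && adj G u w
          || (p.2 w == c) && ~~ ((w == u) || adj G w u)].

Definition uncolored_nbh (u : 'I_n) : {set 'I_n} :=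
  [set w | (p.1 w == None) && ((w == u) || adj G u w)].

Definition extendable (im : seq nat) (ell : nat) : Prop :=
  size im <= ell /\
  forall u, p.1 u = None -> count (blocked u) im + #|uncolored_nbh u| <= ell.

Let g := enc_graph G.
Let c := enc_fun (enc_option enc_nat) p.1.
Let d := enc_fun enc_nat p.2.

Lemma truth_color (w : 'I_n) : truth (tnth_unary c (unary w)) = (p.1 w != None).
Proof. by rewrite tnth_enc_fun; case: (p.1 w). Qed.

Lemma tblocked_enc (u : 'I_n) col : tblocked g c d (unary u) (enc_nat col) = blocked u col.
Proof.
rewrite /tblocked has_tverts; apply: eq_existsb => w.
rewrite truth_color !tnth_enc_fun !tadj_enc_graph teqb_enc_nat teqb_unary.
congr (_ && _ || _); case: (p.1 w) => //= col'.
by rewrite teqb_enc_nat.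
Qed.

Lemma tcheckP ell : exists im,
  [/\ uniq im, forall col, (col \in im) = (Some col \in codom p.1)
    & tcheck g (enc_nat ell) c d <-> extendable im ell].
Proof.
have [im [imE im_uniq mem_im]] := tcolors_enc_seq (codom p.1).
have cE : enc_seq (enc_option enc_nat) (codom p.1) = c.
  rewrite /c /enc_fun /enc_seq codomE.
  by elim: (enum 'I_n) => //= i l ->.
rewrite cE in imE; exists im; split=> //.
have demandE (u : 'I_n) : size (lst (tdemand g c d (unary u))) =
    count (blocked u) im + #|uncolored_nbh u|.
  rewrite /tdemand !size_tcount imE count_map addn0 count_tverts; congr (_ + _).
    by apply: eq_count => col /=; rewrite tblocked_enc.
  congr #|pred_of_set _|; apply/setP => w; rewrite !inE truth_color negbK.
  by rewrite tadj_enc_graph teqb_unary.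
rewrite /tcheck /extendable tleqE bitval_enc_nat imE size_map has_tverts.
rewrite negb_exists; split.
  case/andP=> le /forallP H; split=> // u pu.
  by have := H u; rewrite negbK truth_color pu tleqE bitval_enc_nat demandE.
case=> -> H /=; apply/forallP => u.
rewrite negbK truth_color tleqE bitval_enc_nat demandE.
by case: eqP => //= pu; apply: H.
Qed.

End Criterion.

(** * Extending a partial dominator coloring *)

Section Extension.
Variables (n : nat) (G : sgraph 'I_n) (M : {set 'I_n}) (p : pdcol 'I_n).
Variable im : seq nat.
Hypothesis twinM : twin_cover G M.
Hypothesis pdc : partial_dominator_coloring G p.
Hypothesis coverM : M \subset pdomain p.1.
Hypothesis im_uniq : uniq im.
Hypothesis mem_im : forall c, (c \in im) = (Some c \in codom p.1).

Lemma clnbh_sym u v : (u \in clnbh G v) = (v \in clnbh G u).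
Proof. by rewrite !inE eq_sym (adj_sym G). Qed.

Lemma mem_uncolored_nbh u w :
  (w \in uncolored_nbh G p u) = (p.1 w == None) && (w \in clnbh G u).
Proof. by rewrite !inE. Qed.

Lemma blockedP u c : reflect
  ((exists2 w, p.1 w = Some c & adj G u w) \/
   (exists2 v, p.2 v = c & u \notin clnbh G v)) (blocked G p u c).
Proof.
apply: (iffP existsP) => [[w /orP[/andP[/eqP pw uw]|/andP[/eqP pw uw]]]|].
- by left; exists w.
- by right; exists w => //; rewrite inE eq_sym.
- case=> [[w /eqP pw uw]|[w /eqP pw uw]]; exists w; first by rewrite pw uw.
  by rewrite pw; apply/orP; right; move: uw; rewrite inE eq_sym.
Qed.

Lemma uncolored_twins u v : p.1 u = None -> p.1 v = None ->
  v \in clnbh G u -> clnbh G u = clnbh G v.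
Proof.
have notM w : p.1 w = None -> w \notin M.
  by move=> pw; apply: contraTN isT => /(subsetP coverM); rewrite inE pw.
move=> /notM pu /notM pv; rewrite inE => /orP[/eqP -> //|].
by case/twinM => //; rewrite ?(negbTE pu) ?(negbTE pv).
Qed.

Lemma eq_blocked u v : p.1 u = None -> p.1 v = None ->
  clnbh G u = clnbh G v -> blocked G p u =1 blocked G p v.
Proof.
move=> pu pv uv c.
suff H a b : p.1 b = None -> clnbh G a = clnbh G b ->
    blocked G p a c -> blocked G p b c by apply/idP/idP; apply: H.
move=> pb ab /blockedP[[w pw aw]|[w pw aw]]; apply/blockedP; [left|right].
  exists w => //; have : w \in clnbh G b by rewrite -ab inE aw orbT.
  by rewrite inE => /orP[/eqP wb|//]; rewrite wb pb in pw.
by exists w => //; rewrite clnbh_sym -ab clnbh_sym.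
Qed.

Lemma codom_imE c w : p.1 w = Some c -> c \in im.
Proof. by move=> pw; rewrite mem_im -pw codom_f. Qed.

(* An uncolored closed neighborhood is a clique of twins, so an extension gives
   its vertices distinct colors, none of which is blocked. *)
Lemma extension_extendable chi ell :
  extension G p chi -> ncolors chi <= ell -> extendable G p im ell.
Proof.
case=> [[prop _] agree domc] le_ell.
have im_sub c : c \in im -> c \in codom chi.
  rewrite mem_im => /codomP[w pw].
  have := agree w; rewrite inE -pw => /(_ isT) [->]; exact: codom_f.
split=> [|u pu].
  apply: leq_trans le_ell; apply: uniq_leq_size => // c /im_sub.
  by rewrite mem_undup.
have chi_inj : {in uncolored_nbh G p u &, injective chi}.
  move=> a b; rewrite !mem_uncolored_nbh => /andP[/eqP pa ua] /andP[/eqP pb ub] e.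
  move: ub; rewrite (uncolored_twins pu pa ua) inE => /orP[/eqP //|].
  by move/prop; rewrite e.
pose l := filter (blocked G p u) im ++ map chi (enum (uncolored_nbh G p u)).
have -> : count (blocked G p u) im + #|uncolored_nbh G p u| = size l.
  by rewrite size_cat size_map size_filter cardE.
apply: leq_trans le_ell; apply: uniq_leq_size.
  rewrite cat_uniq filter_uniq //= map_inj_in_uniq ?enum_uniq ?andbT; last first.
    by move=> a b; rewrite !mem_enum; apply: chi_inj.
  apply/hasPn => _ /mapP[w + ->]; rewrite mem_enum mem_uncolored_nbh.
  case/andP=> /eqP pw uw; rewrite mem_filter negb_and; apply/orP; left.
  rewrite (eq_blocked pu pw (uncolored_twins pu pw uw)).
  apply/blockedP => -[[z pz wz]|[v pv wv]].
    have := agree z; rewrite inE pz => /(_ isT) [e].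
    exact: prop wz e.
  by have /subsetP/(_ w) := domc v; rewrite inE pv eqxx (negbTE wv) => /(_ isT).
move=> c; rewrite mem_undup mem_cat => /orP[|/mapP[w _ ->]]; last exact: codom_f.
by rewrite mem_filter => /andP[_ /im_sub].
Qed.

Definition free_colors (ell : nat) (u : 'I_n) : seq nat :=
  filter (predC (blocked G p u)) im ++
  iota (\max_(c <- im) c).+1 (ell - size im).

Definition rank_nbh (u : 'I_n) : nat :=
  index u (enum (uncolored_nbh G p u)).

Definition greedy_extension (ell : nat) : coloring 'I_n :=
  [ffun u => if p.1 u is Some c then c
             else nth 0 (free_colors ell u) (rank_nbh u)].

Lemma im_fresh c k : c \in im -> c \notin iota (\max_(c <- im) c).+1 k.
Proof.
move=> cim; rewrite mem_iota negb_and -leqNgt; apply/orP; left.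
by rewrite (big_rem c) //= leq_maxl.
Qed.

Lemma free_colors_uniq ell u : uniq (free_colors ell u).
Proof.
rewrite cat_uniq filter_uniq //= iota_uniq andbT.
apply/hasPn => c cio; apply/negP; rewrite mem_filter => /andP[_ cim].
by rewrite (negbTE (im_fresh _ cim)) in cio.
Qed.

Section Greedy.
Variable ell : nat.
Hypothesis ext : extendable G p im ell.

Lemma rank_lt u : p.1 u = None -> rank_nbh u < size (free_colors ell u).
Proof.
move=> pu; have [le H] := ext; have := H u pu.
rewrite size_cat size_filter size_iota -(count_predC (blocked G p u) im) in le *.
have : rank_nbh u < #|uncolored_nbh G p u|.
  by rewrite cardE index_mem mem_enum mem_uncolored_nbh pu !inE !eqxx.
by lia.
Qed.

Lemma greedy_colored u c : p.1 u = Some c -> greedy_extension ell u = c.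
Proof. by rewrite ffunE => ->. Qed.

Lemma greedy_uncolored u : p.1 u = None ->
  greedy_extension ell u \in free_colors ell u.
Proof. by move=> pu; rewrite ffunE pu mem_nth // rank_lt. Qed.

Lemma greedy_unblocked u : p.1 u = None -> greedy_extension ell u \in im ->
  ~~ blocked G p u (greedy_extension ell u).
Proof.
move=> pu gim; have := greedy_uncolored pu.
by rewrite mem_cat mem_filter (negbTE (im_fresh _ gim)) orbF => /andP[].
Qed.

Lemma greedy_proper : proper_coloring G (greedy_extension ell).
Proof.
have half u v c : p.1 u = None -> p.1 v = Some c -> adj G u v ->
    greedy_extension ell u <> greedy_extension ell v.
  move=> pu pv uv; rewrite (greedy_colored pv) => e.
  have := greedy_unblocked pu; rewrite e => /(_ (codom_imE pv)) /negP; apply.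
  by apply/blockedP; left; exists v.
move=> u v uv; case pu: (p.1 u) => [c|]; case pv: (p.1 v) => [c'|].
- rewrite (greedy_colored pu) (greedy_colored pv) => e.
  by case: pdc => /(_ u v); rewrite !inE pu pv e => /(_ isT isT uv).
- by move/esym; apply: half pv pu _; rewrite (adj_sym G).
- exact: half pu pv uv.
have tw : clnbh G u = clnbh G v by apply: uncolored_twins; rewrite ?inE ?uv ?orbT.
have Wuv : uncolored_nbh G p u = uncolored_nbh G p v.
  by apply/setP => w; rewrite !mem_uncolored_nbh tw.
have fuv : free_colors ell u = free_colors ell v.
  congr (_ ++ _); apply: eq_filter => c /=; congr (~~ _); exact: eq_blocked.
have := rank_lt pu; have := rank_lt pv.
rewrite !ffunE pu pv fuv /rank_nbh Wuv => ltv ltu /eqP.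
rewrite nth_uniq ?free_colors_uniq // => /eqP e.
have inW w : p.1 w = None -> w \in clnbh G v -> w \in enum (uncolored_nbh G p v).
  by move=> pw wv; rewrite mem_enum mem_uncolored_nbh pw wv eqxx.
have uE : u = v.
  have := congr1 (nth u (enum (uncolored_nbh G p v))) e.
  rewrite !nth_index // inW //; first by rewrite inE eqxx.
  by rewrite -tw inE eqxx.
by rewrite uE (adj_irr G) in uv.
Qed.

Lemma extendable_extension : extension G p (greedy_extension ell).
Proof.
have [_ pdelta pdom] := pdc.
have domc v : dominates G v (color_class (greedy_extension ell) (p.2 v)).
  apply/subsetP => w; rewrite inE => /eqP e.
  case pw: (p.1 w) => [c|].
    by apply: (subsetP (pdom v)); rewrite inE pw -e (greedy_colored pw).
  apply: contraT => wv; have := greedy_unblocked pw.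
  rewrite e mem_im pdelta => /(_ isT) /negP[].
  by apply/blockedP; right; exists v.
split=> //; last first.
  by move=> v; rewrite inE; case pv: (p.1 v) => [c|] // _; rewrite (greedy_colored pv).
split; first exact: greedy_proper.
move=> v; exists (p.2 v) => //.
have /codomP[w /esym pw] := pdelta v.
by rewrite -(greedy_colored pw) codom_f.
Qed.

Lemma ncolors_greedy : ncolors (greedy_extension ell) <= ell.
Proof.
have [le _] := ext.
have sz : size (im ++ iota (\max_(c <- im) c).+1 (ell - size im)) <= ell.
  by rewrite size_cat size_iota; lia.
apply: leq_trans sz; apply: uniq_leq_size; first exact: undup_uniq.
move=> c; rewrite mem_undup => /codomP[u ->].
case pu: (p.1 u) => [c'|].
  by rewrite (greedy_colored pu) mem_cat (codom_imE pu).
have := greedy_uncolored pu; rewrite !mem_cat mem_filter.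
by case/orP=> [/andP[_ ->]//|->]; rewrite orbT.
Qed.

End Greedy.
End Extension.

(** * Running the enumeration first *)

Fixpoint theight (t : tree) : nat :=
  if t is Node l r then (maxn (theight l) (theight r)).+1 else 0.

Lemma theight_tsize t : theight t <= tsize t.
Proof. by elim: t => //= l IHl r IHr; lia. Qed.

Lemma theight_eval s H e :
  (forall x, theight (s x) <= H) -> theight (eval s e) <= H + ecost e.
Proof.
move=> sH; elim: e => [x||e1 IH1 e2 IH2|e IH|e IH] //=.
- by have := sH x; lia.
- by lia.
- by case: (eval s e) IH => //= l r; lia.
- by case: (eval s e) IH => //= l r; lia.
Qed.

Lemma theight_exec c s t s' H : exec c s t s' ->
  (forall x, theight (s x) <= H) -> forall x, theight (s' x) <= H + t.
Proof.
move=> ex; elim: ex H => {c s t s'}.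
- move=> x e s H sH y; rewrite /upd; case: eqP => _.
    by have := theight_eval e sH; lia.
  by have := sH y; lia.
- by move=> c1 c2 s s1 s2 t1 t2 _ IH1 _ IH2 H sH y; rewrite addnA; apply/IH2/IH1.
- by move=> e c1 c2 s s' t _ IH H sH y; have := IH H sH y; lia.
- by move=> e c s _ H sH y; have := sH y; lia.
- move=> e c s s1 s2 t1 t2 _ _ IH1 _ IH2 H sH y.
  by have := IH2 _ (IH1 _ sH) y; lia.
Qed.

Fixpoint evars (e : expr) : nat :=
  match e with
  | EVar x => x.+1
  | ENil => 0
  | ECons e1 e2 => maxn (evars e1) (evars e2)
  | EHd e1 | ETl e1 => evars e1
  end.

Fixpoint cvars (c : cmd) : nat :=
  match c with
  | CAssign x e => maxn x.+1 (evars e)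
  | CSeq c1 c2 => maxn (cvars c1) (cvars c2)
  | CIf e c1 c2 => maxn (evars e) (maxn (cvars c1) (cvars c2))
  | CWhile e c => maxn (evars e) (cvars c)
  end.

Lemma eq_eval K s u e : evars e <= K -> (forall x, x < K -> s x = u x) ->
  eval s e = eval u e.
Proof.
move=> + su; elim: e => [x||e1 IH1 e2 IH2|e IH|e IH] //=.
- by move/su.
- by rewrite geq_max => /andP[/IH1 -> /IH2 ->].
- by move/IH->.
- by move/IH->.
Qed.

Lemma exec_frame K c s t s' u : exec c s t s' -> cvars c <= K ->
  (forall x, x < K -> s x = u x) ->
  exists u', [/\ exec c u t u', forall x, x < K -> s' x = u' x
               & forall x, K <= x -> u' x = u x].
Proof.
move=> ex; elim: ex u => {c s t s'}.
- move=> x e s u /=; rewrite geq_max => /andP[xK eK] su.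
  exists (upd u x (eval u e)); split; first exact: ExecAssign.
    by move=> y yK; rewrite /upd (eq_eval eK su); case: eqP => // _; apply: su.
  by move=> y Ky; rewrite upd_ne // neq_ltn (leq_trans xK Ky) orbT.
- move=> c1 c2 s s1 s2 t1 t2 _ IH1 _ IH2 u /=; rewrite geq_max => /andP[c1K c2K] su.
  have [u1 [e1 v1 w1]] := IH1 u c1K su; have [u2 [e2 v2 w2]] := IH2 u1 c2K v1.
  exists u2; split=> //; first exact: ExecSeq e1 e2.
  by move=> y Ky; rewrite w2 // w1.
- move=> e c1 c2 s s' t _ IH u /=; rewrite !geq_max => /and3P[eK c1K c2K] su.
  have [|u1 [e1 v1 w1]] := IH u _ su; first by case: (truth _).
  by exists u1; split=> //; apply: ExecIf; rewrite -(eq_eval eK su).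
- move=> e c s ne u /=; rewrite geq_max => /andP[eK cK] su.
  by exists u; split=> //; apply: ExecWhileEnd; rewrite -(eq_eval eK su).
- move=> e c s s1 s2 t1 t2 te _ IH1 _ IH2 u /=; rewrite geq_max => /andP[eK cK] su.
  have [u1 [e1 v1 w1]] := IH1 u cK su.
  have [|u2 [e2 v2 w2]] := IH2 u1 _ v1; first by rewrite /= geq_max eK.
  exists u2; split=> //; last by move=> y Ky; rewrite w2 // w1.
  by apply: ExecWhileStep e1 e2; rewrite -(eq_eval eK su).
Qed.

Lemma size_enc_seq_height (A : Type) (enc : A -> tree) l :
  size l <= theight (enc_seq enc l).
Proof. by elim: l => //= a l IH; lia. Qed.

Lemma theight_enc_seq (A : Type) (enc : A -> tree) l a :
  List.In a l -> theight (enc a) <= theight (enc_seq enc l).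
Proof.
elim: l => //= b l IH [->|/IH]; rewrite /enc_seq /= -/(enc_seq _ _); lia.
Qed.

Lemma tsize_enc_seq_height (A : Type) (enc : A -> tree) l H B :
  (forall a, theight (enc a) <= H -> tsize (enc a) <= B) ->
  theight (enc_seq enc l) <= H -> tsize (enc_seq enc l) <= H * B.+1 + 1.
Proof.
move=> encB lH; apply: leq_trans (tsize_enc_seq (B := B) _) _.
  by move=> a al; apply/encB/(leq_trans (theight_enc_seq enc al)).
by rewrite leq_add2r leq_mul2r (leq_trans (size_enc_seq_height enc l) lH) orbT.
Qed.

Lemma tsize_enc_nat m : tsize (enc_nat m) <= 4 * theight (enc_nat m) + 1.
Proof.
rewrite /enc_nat; case: (bin_of_nat m) => //.
by elim=> //= q IH; lia.
Qed.

Lemma tsize_enc_option_nat o H :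
  theight (enc_option enc_nat o) <= H -> tsize (enc_option enc_nat o) <= 4 * H + 3.
Proof. by case: o => [m|] /=; [have := tsize_enc_nat m|]; lia. Qed.

Lemma tsize_enc_pdcols n (l : seq (pdcol 'I_n)) H :
  theight (enc_seq (@enc_pdcol n) l) <= H ->
  tsize (enc_seq (@enc_pdcol n) l) <= 24 * H.+1 ^ 3.
Proof.
move=> lH.
have := @tsize_enc_seq_height _ (@enc_pdcol n) l H (2 * (H * (4 * H + 4) + 1) + 1).
have -> : 24 * H.+1 ^ 3 = 24 * (H.+1 * H.+1 * H.+1) by rewrite !expnS; lia.
move=> /(_ _ lH) P; apply: leq_trans (P _) _; last by nia.
move=> p; rewrite /enc_pdcol [theight _]/= [tsize _]/= => pH.
have [h1 h2] : theight (enc_fun (enc_option enc_nat) p.1) <= H /\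
               theight (enc_fun enc_nat p.2) <= H.
  by move: pH; rewrite gtn_max => /andP[/ltnW ? /ltnW ?].
have s1 : tsize (enc_fun (enc_option enc_nat) p.1) <= H * (4 * H + 4) + 1.
  rewrite [4 * H + 4]addnS; apply: tsize_enc_seq_height h1 => i.
  exact: tsize_enc_option_nat.
have s2 : tsize (enc_fun enc_nat p.2) <= H * (4 * H + 4) + 1.
  rewrite [4 * H + 4]addnS; apply: tsize_enc_seq_height h2 => i hi.
  by have := tsize_enc_nat (p.2 i); lia.
rewrite addn1 ltnS mul2n -addnn; exact: leq_add.
Qed.

(* [P] runs next to a copy of its input in a variable that it does not use. *)
Lemma runs_then P b : pdec b -> exists Q a d, forall x y t S,
  runs P x y t -> (theight y <= tsize x + t -> tsize y <= S) ->
  exists2 t', runs Q x (enc_bool (b (Node x y))) t'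
            & t' <= t + a * (tsize x + S).+1 ^ d + 8.
Proof.
move=> [C [T [[a [d bT]] _ H]]].
pose K := (cvars P).+1.
exists (CSeq (CAssign K (EVar 0)) (CSeq P (CSeq
  (CAssign K (ECons (EVar K) (EVar 0))) (CSeq (C K) (CAssign 0 (EVar K)))))), a, d.
move=> x y t S [s ex s0] yS.
have hs z : theight (upd (fun=> Leaf) 0 x z) <= tsize x.
  by rewrite /upd; case: eqP => // _; apply: theight_tsize.
have {}yS : tsize y <= S by apply: yS; rewrite -s0; apply: theight_exec ex hs 0.
set s1 := upd _ 0 x in ex hs; pose u1 := upd s1 K x.
have [|z zK|u2 [e2 v2 w2]] := @exec_frame K _ _ _ _ u1 ex; first exact: leqnSn.
  by rewrite /u1 upd_ne // neq_ltn zK.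
have u2K : u2 K = x by rewrite w2 // /u1 upd_eq.
have u20 : u2 0 = y by rewrite -v2.
pose u3 := upd u2 K (Node x y).
have [t4 [u4 [e4 v4 w4 l4]]] := H K u3.
rewrite /u3 upd_eq in v4 l4.
eexists.
  exists (upd u4 0 (u4 K)); last by rewrite upd_eq v4.
  apply: ExecSeq; first exact: ExecAssign.
  apply: ExecSeq; first exact: e2.
  apply: ExecSeq; first exact: ExecAssign.
  rewrite /= u2K u20; apply: ExecSeq; [exact: e4|exact: ExecAssign].
have : t4 <= a * (tsize x + S).+1 ^ d.
  apply: leq_trans l4 _; apply: leq_trans (bT _) _.
  by rewrite leq_mul2l leq_expl ?orbT //= ltnS leq_add2l.
by rewrite /=; lia.
Qed.

Lemma exp_klogk_gt0 b k : 0 < exp_klogk b k.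
Proof. by rewrite /exp_klogk; case: k => [|k]; rewrite ?muln0 // expn_gt0. Qed.

Lemma exp_klogkX b k m : exp_klogk b k ^ m = exp_klogk (b * m) k.
Proof. by rewrite /exp_klogk -expnM mulnAC. Qed.

Lemma Ostar_klogk_poly A D a b d : exists a' b' d', forall k n t t',
  0 < n -> t <= a * exp_klogk b k * n ^ d ->
  t' <= t + A * (n + 24 * (n + t).+1 ^ 3).+1 ^ D + 8 ->
  t' <= a' * exp_klogk b' k * n ^ d'.
Proof.
pose m := 3 * D + 1.
exists ((9 + A * 650 ^ D) * a.+1 ^ m), (b * m), (d.+1 * m) => k n t t' n0 tle t'le.
rewrite -exp_klogkX expnM -!mulnA -!expnMn mulnA.
set E := exp_klogk b k in tle *; have E0 : 0 < E := exp_klogk_gt0 b k.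
set Z := a.+1 * E * n ^ d.+1.
have nd0 : 0 < n ^ d by rewrite expn_gt0 n0.
have ZE : Z = a.+1 * E * n ^ d * n by rewrite /Z expnSr mulnA.
have Zn : n <= Z by rewrite ZE leq_pmull // !muln_gt0 E0 nd0.
have Zt : t <= Z.
  apply: leq_trans tle _; rewrite ZE; apply: leq_trans (leq_pmulr _ n0).
  by rewrite !leq_mul2r leqnSn !orbT.
have Z0 : 0 < Z by apply: leq_trans Zn.
have H3 : (n + t).+1 ^ 3 <= 27 * Z ^ 3.
  by rewrite -[27]/(3 ^ 3) -expnMn leq_expl //; lia.
have Z3 : Z <= Z ^ 3 by rewrite -{1}[Z]expn1 leq_pexp2l.
have H4 : (n + 24 * (n + t).+1 ^ 3).+1 ^ D <= 650 ^ D * Z ^ (3 * D).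
  by rewrite expnM -expnMn leq_expl //; lia.
have H5 : Z ^ (3 * D) <= Z ^ m by rewrite leq_pexp2l // leq_addr.
have H6 : Z <= Z ^ m by rewrite -{1}[Z]expn1 leq_pexp2l // leq_addl.
have H7 : A * (n + 24 * (n + t).+1 ^ 3).+1 ^ D <= A * 650 ^ D * Z ^ m.
  rewrite -mulnA leq_mul2l; apply/orP; right; apply: leq_trans H4 _.
  by rewrite leq_mul2l H5 orbT.
by apply: leq_trans t'le _; rewrite mulnDl; lia.
Qed.

Lemma tdecide_correct n (G : sgraph 'I_n) ell (M : {set 'I_n})
    (s : seq (pdcol 'I_n)) :
  twin_cover G M ->
  (forall p, p \in s -> partial_dominator_coloring G p) ->
  (forall p, p \in s -> M \subset pdomain p.1) ->
  (forall chi', dominator_coloring G chi' -> exists2 p, p \in s &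
     exists2 chi, extension G p chi & ncolors chi <= ncolors chi') ->
  tdecide (Node (enc_instance (Instance G ell M)) (enc_seq (@enc_pdcol n) s))
  <-> has_dominator_coloring G ell.
Proof.
move=> twinM pdc cov extG; rewrite /tdecide lst_enc_seq has_map; split.
  case/hasP=> p ps /= chk.
  have [im [im_uniq mem_im [/(_ chk) ext _]]] := tcheckP G p ell.
  exists (greedy_extension G p im ell); last exact: ncolors_greedy.
  by have [] := extendable_extension twinM (pdc p ps) (cov p ps) im_uniq mem_im ext.
case=> chi' /extG[p ps [chi ext le]] le_ell; apply/hasP; exists p => //=.
have [im [im_uniq mem_im [_]]] := tcheckP G p ell; apply.
exact: extension_extendable twinM (cov p ps) im_uniq mem_im _ _ ext (leq_trans le le_ell).
Qed.

Theorem theorem10 (J : instance -> Prop)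
  (Gamma : forall I : instance, {fset pdcol 'I_(inst_order I)})
  (twinJ : forall I, J I -> twin_cover (inst_graph I) (inst_cover I))
  (pdcGamma : forall I, J I -> forall p, p \in Gamma I ->
     partial_dominator_coloring (inst_graph I) p)
  (coverGamma : forall I, J I -> forall p, p \in Gamma I ->
     inst_cover I \subset pdomain p.1)
  (extGamma : forall I, J I -> forall chi', dominator_coloring (inst_graph I) chi' ->
     exists2 p, p \in Gamma I &
     exists2 chi, extension (inst_graph I) p chi & ncolors chi <= ncolors chi')
  (cardGamma : exists a b : nat, forall I, J I ->
     #|` Gamma I| <= a * exp_klogk b (param I))
  (timeGamma : constructible_in_Ostar_klogk J Gamma) :
  decidable_in_Ostar_klogk J
    (fun I => has_dominator_coloring (inst_graph I) (inst_ell I)).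
Proof.
have [P [a [b [d HP]]]] := timeGamma.
have [Q [A [D HQ]]] := runs_then P pdec_tdecide.
have [a' [b' [d' bound]]] := Ostar_klogk_poly A D a b d.
exists Q, a', b', d' => I JI.
have [y [t [run tle [s sE yE]]]] := HP I JI.
have [t' run' t'le] := HQ _ _ _ (24 * (tsize (enc_instance I) + t).+1 ^ 3) run
  (fun hy => ltac:(by rewrite yE in hy *; apply: tsize_enc_pdcols)).
exists (enc_bool (tdecide (Node (enc_instance I) y))), t'; split=> //.
  exact: bound (tsize_gt0 _) tle t'le.
exists (tdecide (Node (enc_instance I) y)) => //; rewrite yE.
case: I JI s sE {yE y run tle run' t'le} => n G ell M JI s sE.
apply: tdecide_correct (twinJ _ JI) _ _ _.
- by move=> p; rewrite sE; apply: pdcGamma.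
- by move=> p; rewrite sE; apply: coverGamma.
- by move=> chi' /(extGamma _ JI)[p pG H]; exists p; rewrite ?sE.
Qed.
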